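(* $t(K(11,4))=\frac{7}{4}$. Moreover, if $S$ is a vertex cut of $K(11,4)$ such that $\frac{|S|}{c(K(11,4)\setminus S)} = \frac{7}{4}$, then $S$ is the complement of a maximum independent set of $K(11,4)$.
   Context: The Kneser graph $K(n,k)$ has as vertices the $k$-element subsets of $[n]=\{1,\dots,n\}$, two vertices being adjacent iff they are disjoint. A vertex cut is a set $S$ of vertices whose removal disconnects the graph; $c(G\setminus S)$ is the number of connected components after deleting $S$; the toughness is $t(G)=\min_S |S|/c(G\setminus S)$ over vertex cuts $S$. *)

(* Defs.v *)
From mathcomp Require Import all_boot all_order all_algebra.
Set Implicit Arguments. Unset Strict Implicit. Unset Printing Implicit Defensive.
Import Order.TTheory GRing.Theory Num.Theory.

Definition kvert (n k : nat) := {A : {set 'I_n} | #|A| == k}.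

Definition kadj (n k : nat) : rel (kvert n k) :=
  fun A B => [disjoint val A & val B].

Definition del_rel (T : finType) (e : rel T) (S : {set T}) : rel T :=
  fun x y => [&& x \notin S, y \notin S & e x y].

Definition ncomp_del (T : finType) (e : rel T) (S : {set T}) : nat :=
  n_comp (del_rel e S) (~: S).

Definition vertex_cut (T : finType) (e : rel T) (S : {set T}) : bool :=
  1 < ncomp_del e S.

Definition cut_ratio (T : finType) (e : rel T) (S : {set T}) : rat :=
  (#|S|%:R / (ncomp_del e S)%:R)%R.

Definition is_toughness (T : finType) (e : rel T) (t : rat) : Prop :=
  (exists S : {set T}, vertex_cut e S /\ cut_ratio e S = t) /\
  (forall S : {set T}, vertex_cut e S -> (t <= cut_ratio e S)%R).

Definition independent (T : finType) (e : rel T) (I : {set T}) : bool :=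
  [forall x in I, forall y in I, ~~ e x y].

Definition max_independent (T : finType) (e : rel T) (I : {set T}) : bool :=
  independent e I && [forall J : {set T}, independent e J ==> (#|J| <= #|I|)].

(* Main.v *)
(** K(11,4) is 35-regular with eigenvalues 35, -20, 10, -4, 1.  Let [S] be a
    vertex cut leaving [c] components, of sizes [n_i] and with [m_i] arcs
    (ordered adjacent pairs).  Since the least eigenvalue is -20,
    [f^T A f + 20 |f|^2 >= (sum f)^2 / 6] for every vector [f]; taking for [f]
    the value [n_i / (m_i + 20 n_i)] on the i-th component gives
    [sum n_i^2 / (m_i + 20 n_i) <= 6].  Every summand is at least
    [(n_i + 7/4) / 55], with equality only for singletons: when [n_i <= 33] this
    follows from [m_i <= n_i (n_i - 1)], and for a larger component from the
    spectral gap, [m_i <= 31 n_i + 4 n_i^2 / 330], together with [n_i <= 295]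
    (the component misses the 35 neighbours of a vertex of another one).
    Summing, [330 - |S| + 7 c / 4 <= 330], and equality forces [~: S] to be
    independent of size 120.  The two spectral inequalities are sums of squares
    in the "shadows" of [f]. *)
Require Import Defs.
From mathcomp Require Import all_boot all_order all_algebra.
From mathcomp Require Import zify ring lra.
Set Implicit Arguments.
Unset Strict Implicit.
Unset Printing Implicit Defensive.
Import Order.TTheory GRing.Theory Num.Theory.
Local Open Scope ring_scope.

(** * Up and down operators on the Boolean lattice *)

Section UpDown.
Variables (R : realFieldType) (T : finType).
Implicit Types (g h : {set T} -> R) (S : {set T}).

Definition up g S : R := \sum_(x in S) g (S :\ x).
Definition dn g S : R := \sum_(x in ~: S) g (x |: S).
Definition dot g h : R := \sum_S g S * h S.

Lemma dotC g h : dot g h = dot h g.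
Proof. by apply: eq_bigr => S _; rewrite mulrC. Qed.

Lemma dotDr g h1 h2 : dot g (fun S => h1 S + h2 S) = dot g h1 + dot g h2.
Proof. by rewrite -big_split; apply: eq_bigr => S _; rewrite mulrDr. Qed.

Lemma dotZr g a h : dot g (fun S => a * h S) = a * dot g h.
Proof. by rewrite mulr_sumr; apply: eq_bigr => S _; rewrite mulrCA. Qed.

Lemma eq_dotr g h1 h2 : h1 =1 h2 -> dot g h1 = dot g h2.
Proof. by move=> eqh; apply: eq_bigr => S _; rewrite eqh. Qed.

Lemma dot_ge0 g : 0 <= dot g g.
Proof. by apply: sumr_ge0 => S _; rewrite -expr2 sqr_ge0. Qed.

Lemma eq_up g h : g =1 h -> up g =1 up h.
Proof. by move=> eqgh S; apply: eq_bigr => x _. Qed.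

Lemma upZ a g S : up (fun S => a * g S) S = a * up g S.
Proof. by rewrite /up mulr_sumr. Qed.

Lemma upD g h S : up (fun S => g S + h S) S = up g S + up h S.
Proof. by rewrite /up big_split. Qed.

(** Both sides are the sum of [g S * h (x |: S)] over the pairs with [x \notin S]. *)
Lemma dot_up g h : dot (up g) h = dot g (dn h).
Proof.
rewrite /dot /up /dn.
under eq_bigr do rewrite mulr_suml.
under [RHS]eq_bigr do rewrite mulr_sumr.
rewrite (exchange_big_dep xpredT) //= [RHS](exchange_big_dep xpredT) //=.
apply: eq_bigr => x _.
rewrite (reindex_onto (fun S => x |: S) (fun S => S :\ x)) /=; last first.
  by move=> S xS; rewrite setD1K.
apply: eq_big => [S | S].
  rewrite setU11 /= inE; apply/eqP/idP => [<- | xS]; first by rewrite !inE eqxx.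
  by rewrite setU1K.
by case/andP=> _ /eqP ->.
Qed.

(* The sl_2 relation of the Boolean lattice. *)
Lemma dn_up g S :
  dn (up g) S = up (dn g) S + (#|T|%:R - 2 * #|S|%:R) * g S.
Proof.
(* Undoing the move just made gives back [g S]. The other terms swap a point of [S] for one outside,
   and agree in both orders. *)
have dnE : dn (up g) S = #|~: S|%:R * g S
    + \sum_(x in ~: S) \sum_(y in S) g ((x |: S) :\ y).
  rewrite -sum1_card natr_sum mulr_suml -big_split /=; apply: eq_bigr => x.
  rewrite inE => xS; rewrite mul1r /up (big_setD1 x) ?setU11 //= setU1K //.
have upE : up (dn g) S = #|S|%:R * g S
    + \sum_(y in S) \sum_(x in ~: S) g (x |: (S :\ y)).
  rewrite -sum1_card natr_sum mulr_suml -big_split /=; apply: eq_bigr => y yS.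
  rewrite mul1r /dn (big_setD1 y) /=; last by rewrite !inE eqxx.
  rewrite setD1K //; congr (_ + _); apply: eq_bigl => x.
  by rewrite !inE negb_and negbK; case: eqP => [->|//]; rewrite yS.
rewrite dnE upE exchange_big /= -(cardsC S) natrD.
rewrite (_ : \sum_(j in S) _
  = \sum_(y in S) \sum_(x in ~: S) g (x |: (S :\ y))).
  ring.
apply: eq_bigr => y yS; apply: eq_bigr => x; rewrite inE => xS; congr g.
apply/setP=> z; rewrite !inE.
by case: (z =P y) => // ->; case: (y =P x) xS => // <-; rewrite yS.
Qed.

Lemma dot_upC g h : dot g (up h) = dot (dn g) h.
Proof. by rewrite dotC dot_up dotC. Qed.
End UpDown.

(** * Shadows of a function on k-sets and their norms *)

Section Shadows.
Variables (R : realFieldType) (n k : nat) (f : kvert n k -> R).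

(* For [f] on the k-sets, [shad i] lives on the sets of size k - i. *)
Definition shad (i : nat) (S : {set 'I_n}) : R :=
  if (#|S| + i)%N == k then \sum_(v : kvert n k | S \subset val v) f v else 0.

Notation sq i := (dot (shad i) (shad i)).
Notation dlt := (n%:R - 2 * k%:R : R).

(** Each k-set [v] containing [S] is reached once for every point of [val v :\: S], and there are
    [i.+1] of them. *)
Lemma dn_shad i S : dn (shad i) S = i.+1%:R * shad i.+1 S.
Proof.
rewrite /dn /shad addnS -addSn.
have [eqk | neqk] := eqVneq (#|S|.+1 + i)%N k; last first.
  rewrite mulr0 big1 // => x; rewrite inE => xS.
  by rewrite cardsU1 xS add1n (negbTE neqk).
rewrite mulr_sumr.
under eq_bigr => x.
  rewrite inE => xS; rewrite cardsU1 xS add1n eqk eqxx; over.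
rewrite (exchange_big_dep (fun v : kvert n k => S \subset (val v : {set 'I_n})))
  /=; last first.
  by move=> x v _; apply: subset_trans; rewrite subsetUr.
apply: eq_bigr => v Sv; rewrite sumr_const mulr_natl; congr (_ *+ _).
rewrite -[RHS]/(i.+1) -(_ : #|val v :\: S| = i.+1); last first.
  rewrite cardsD (setIidPr Sv) (eqP (valP v)); lia.
by apply: eq_card => x; rewrite unfold_in /= subUset sub1set Sv andbT !inE.
Qed.

(** Turns the coefficient of [dn_up] into a scalar: [#|S| = k - i] wherever [shad i] is nonzero. *)
Lemma shad_level i (S : {set 'I_n}) :
  (n%:R - 2 * #|S|%:R) * shad i S = (dlt + 2 * i%:R) * shad i S.
Proof.
rewrite /shad; case: eqP => [eqk|_]; last by rewrite !mulr0.
have -> : k%:R = #|S|%:R + i%:R :> R by rewrite -natrD eqk.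
ring.
Qed.

Lemma up_shad_level i (S : {set 'I_n}) :
  (n%:R - 2 * #|S|%:R) * up (shad i) S
  = (dlt + 2 * i%:R - 2) * up (shad i) S.
Proof.
rewrite /up !mulr_sumr; apply: eq_bigr => x xS.
rewrite (cardsD1 x S) xS natrD mulr1n /shad; case: eqP => [eqk|_];
  last by rewrite !mulr0.
have -> : k%:R = #|S :\ x|%:R + i%:R :> R by rewrite -natrD eqk.
ring.
Qed.

Lemma dn_up_shad i S :
  dn (up (shad i)) S
  = i.+1%:R * up (shad i.+1) S + (dlt + 2 * i%:R) * shad i S.
Proof.
rewrite dn_up card_ord shad_level -upZ; congr (_ + _).
by apply: eq_up => A; exact: dn_shad.
Qed.

Lemma dn_up2_shad i S :
  dn (up (up (shad i))) S
  = i.+1%:R * up (up (shad i.+1)) S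
    + (2 * dlt + 4 * i%:R - 2) * up (shad i) S.
Proof.
rewrite dn_up card_ord up_shad_level (eq_up (dn_up_shad i)) upD.
rewrite upZ upZ; ring.
Qed.

(** With the next four lemmas, reduces the inner products in [shad_sqr_ge0] to the norms [sq j], by
    moving [up] across as [dn] and commuting. *)
Lemma dot_shad_up i : dot (shad i) (up (shad i.+1)) = i.+1%:R * sq i.+1.
Proof. by rewrite dot_upC dotC (eq_dotr _ (dn_shad i)) dotZr. Qed.

Lemma dot_up_up i :
  dot (up (shad i)) (up (shad i))
  = i.+1%:R ^+ 2 * sq i.+1 + (dlt + 2 * i%:R) * sq i.
Proof.
rewrite dot_up (eq_dotr _ (dn_up_shad i)) dotDr !dotZr dot_shad_up; ring.
Qed.

Lemma dot_shad_up2 i :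
  dot (shad i) (up (up (shad i.+2))) = i.+1%:R * i.+2%:R * sq i.+2.
Proof.
by rewrite dot_upC dotC (eq_dotr _ (dn_shad i)) dotZr dotC dot_shad_up mulrA.
Qed.

Lemma dot_up_up2 i :
  dot (up (shad i)) (up (up (shad i.+1)))
  = i.+1%:R * dot (up (shad i.+1)) (up (shad i.+1))
    + (dlt + 2 * i%:R) * i.+1%:R * sq i.+1.
Proof.
rewrite dot_upC dotC (eq_dotr _ (dn_up_shad i)) dotDr !dotZr.
by rewrite (dotC _ (shad i)) dot_shad_up mulrA.
Qed.

Lemma dot_up2_up2 i :
  dot (up (up (shad i))) (up (up (shad i)))
  = i.+1%:R * dot (up (shad i)) (up (up (shad i.+1)))
    + (2 * dlt + 4 * i%:R - 2) * dot (up (shad i)) (up (shad i)).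
Proof. by rewrite dot_up (eq_dotr _ (dn_up2_shad i)) dotDr !dotZr. Qed.

(** The expanded norm of a combination of three vectors that all live on level [k - i]; [a] and [b]
    are left free to kill chosen eigenspaces. *)
Lemma shad_sqr_ge0 (i : nat) (a b : R) :
  0 <= sq i + 2 * a * dot (shad i) (up (shad i.+1))
       + a ^+ 2 * dot (up (shad i.+1)) (up (shad i.+1))
       + 2 * b * dot (shad i) (up (up (shad i.+2)))
       + 2 * a * b * dot (up (shad i.+1)) (up (up (shad i.+2)))
       + b ^+ 2 * dot (up (up (shad i.+2))) (up (up (shad i.+2))).
Proof.
apply: le_trans (dot_ge0 (fun S => shad i S
  + (a * up (shad i.+1) S + b * up (up (shad i.+2)) S))) _.
rewrite le_eqVlt; apply/orP; left; apply/eqP.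
rewrite /dot !mulr_sumr -!big_split /=; apply: eq_bigr => S _; ring.
Qed.

Lemma shad_top : sq 0 = \sum_v f v ^+ 2.
Proof.
rewrite (partition_big val xpredT) //=; apply: eq_bigr => S _.
rewrite /shad addn0; case: (boolP (#|S| == k)) => [cS | ncS]; last first.
  rewrite mul0r big1 // => v /eqP vS; case/negP: ncS.
  by rewrite -vS; exact: (valP v).
pose v0 : kvert n k := Sub S cS.
rewrite (big_pred1 v0) => [|v]; last first.
  rewrite -[RHS](inj_eq val_inj) /= eq_sym eqEcard (eqP cS) (eqP (valP v)).
  by rewrite leqnn andbT.
by rewrite (big_pred1 v0) ?expr2 // => v; rewrite -[RHS](inj_eq val_inj).
Qed.

Lemma shad_bottom : sq k = (\sum_v f v) ^+ 2.
Proof.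
rewrite /dot (bigD1 set0) //= big1 ?addr0 => [|S S0].
  by rewrite /shad cards0 add0n eqxx expr2; congr (_ * _); apply: eq_bigl => v;
     rewrite sub0set.
rewrite /shad ifN ?mul0r // -{2}[k]add0n eqn_add2r.
by rewrite cards_eq0.
Qed.

Lemma shad_gt i : (k < i)%N -> sq i = 0.
Proof.
move=> lt_ki; rewrite /dot big1 // => S _.
by rewrite /shad ifN ?mul0r //; lia.
Qed.

(** The signed sum expands the product of [1 - (x \in A)] over all [x], which vanishes once [A] has
    a point. *)
Lemma sum_sign_subset (T : finType) (A : {set T}) :
  \sum_(S : {set T} | S \subset A) (-1) ^+ #|S| = (A == set0)%:R :> R.
Proof.
transitivity (\prod_(x : T) (- (x \in A)%:R + 1) : R).
  rewrite bigA_distr big_mkcond /=; apply: eq_bigr => S _.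
  case: subsetP => [SA | nSA].
    rewrite -prodr_const big_mkcond /=; apply: eq_bigr => x _.
    by case: ifP => // xS; rewrite SA.
  have /subsetPn [x xS xA] : ~~ (S \subset A) by apply/subsetP.
  by rewrite (bigD1 x) //= xS (negbTE xA) oppr0 mul0r.
case: eqP => [->|/eqP/set0Pn [x xA]].
  by rewrite big1 // => x _; rewrite inE oppr0 add0r.
by rewrite (bigD1 x) //= xA addNr mul0r.
Qed.

(** Inclusion-exclusion: disjointness of [v] and [w] is the signed count of the subsets of their
    intersection. Summing over [v] and [w] first leaves one square for each [S]. *)
Lemma quad_shad :
  \sum_v \sum_(w | kadj v w) f v * f w = \sum_(i < k.+1) (-1) ^+ (k - i) * sq i.
Proof.
transitivity (\sum_(S : {set 'I_n}) (-1) ^+ #|S|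
   * (\sum_(v : kvert n k | S \subset val v) f v) ^+ 2).
  under eq_bigr => v _.
    rewrite big_mkcond /=; under eq_bigr => w _.
      rewrite (_ : (if _ then _ else _) = (f v * f w) *
         \sum_(S : {set 'I_n} | S \subset val v :&: val w) (-1) ^+ #|S|);
        last first.
        rewrite sum_sign_subset /kadj -setI_eq0.
        by case: ifP; rewrite ?mulr1 ?mulr0.
      rewrite mulr_sumr; over.
    over.
  under [RHS]eq_bigr => S _.
    rewrite expr2 big_distrlr /= mulr_sumr; under eq_bigr do rewrite mulr_sumr.
    over.
  rewrite [RHS](exchange_big_dep xpredT) //=; apply: eq_bigr => v _.
  under [RHS]eq_bigr do rewrite big_mkcond /=.
  rewrite [RHS]exchange_big /=; apply: eq_bigr => w _.
  rewrite -big_mkcondr /=; apply: eq_big => [S | S _]; first by rewrite subsetI.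
  by rewrite mulrC.
under [RHS]eq_bigr do rewrite mulr_sumr.
rewrite exchange_big /=; apply: eq_bigr => S _.
(* A set larger than [k] lies in no vertex; any other [S] contributes only at [i = k - #|S|]. *)
have [lt_kS | le_Sk] := ltnP k #|S|.
  rewrite big1 => [|v /subset_leq_card]; last first.
    by rewrite (eqP (valP v)) leqNgt lt_kS.
  rewrite expr0n mulr0 big1 // => i _.
  by rewrite /shad ifN ?mul0r ?mulr0 //; lia.
have lt_i : (k - #|S| < k.+1)%N by rewrite ltnS leq_subr.
rewrite (bigD1 (Ordinal lt_i)) //= [X in _ = _ + X]big1 ?addr0 => [|i].
  by rewrite /shad subnKC // eqxx subKn // expr2.
rewrite -val_eqE /= => neq; rewrite /shad ifN ?mul0r ?mulr0 //.
by apply: contra neq => /eqP eqk; rewrite -[X in _ == (X - _)%N]eqk addKn.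
Qed.
End Shadows.

(** * The two spectral inequalities *)

Section Kneser11_4.
Variables (R : realFieldType) (f : kvert 11 4 -> R).

Let norm_expand :=
  (dot_shad_up f, dot_up_up f, dot_shad_up2 f, dot_up_up2 f, dot_up2_up2 f).

(* In [quad_lower], the i-th square vanishes on the eigenspaces of 35 and -20:
   in the operator [up o dn] on level [4 - i] it is proportional to
   (X - 21)(X - 32), (X - 16)(X - 27), (X - 9)(X - 20) for i = 0, 1, 2. In
   [quad_upper], every square vanishes on constants. *)
Lemma quad_lower :
  (\sum_v f v) ^+ 2 / 6
  <= \sum_v \sum_(w | kadj v w) f v * f w + 20 * \sum_v f v ^+ 2.
Proof.
rewrite quad_shad -shad_bottom -shad_top !big_ord_recr big_ord0 /=.
have := shad_sqr_ge0 f 0 (- 1 / 14) (1 / 336).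
have := shad_sqr_ge0 f 1 (- 1 / 6) (1 / 72).
have := shad_sqr_ge0 f 2 (- 1 / 3) (1 / 15).
(* The squares at [i = 1] and [i = 2] reach [sq 5] and [sq 6], below the empty set, where shadows
   vanish. *)
rewrite !norm_expand (@shad_gt _ _ _ f 5) // (@shad_gt _ _ _ f 6) //.
lra.
Qed.

Lemma quad_upper :
  \sum_v \sum_(w | kadj v w) f v * f w
  <= 31 * \sum_v f v ^+ 2 + 4 / 330 * (\sum_v f v) ^+ 2.
Proof.
rewrite quad_shad -shad_bottom -shad_top !big_ord_recr big_ord0 /=.
have := shad_sqr_ge0 f 0 (- 1 / 32) 0.
have := shad_sqr_ge0 f 1 (- 2 / 7) (2 / 63).
have := shad_sqr_ge0 f 2 (- 3 / 20) 0.
have := shad_sqr_ge0 f 3 (- 4 / 11) 0.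
rewrite !norm_expand (@shad_gt _ _ _ f 5) //.
lra.
Qed.
End Kneser11_4.

(** * Components after deletion, and sums over them *)

Section Components.
Variables (T : finType) (e : rel T) (S : {set T}).
Hypothesis e_sym : symmetric e.

Notation comp_root := (fingraph.root (del_rel e S)).

(** One representative per component. Deleted vertices are isolated in [del_rel], hence their own
    roots, and must be excluded. *)
Definition comp_roots : {set T} := [set x in ~: S | comp_root x == x].
Definition comp_set (x : T) : {set T} := [set y in ~: S | comp_root y == x].

Lemma ncomp_delE : ncomp_del e S = #|comp_roots|.
Proof.
rewrite /ncomp_del /n_comp_mem; apply: eq_card => x.
by rewrite !inE /roots /= andbC.
Qed.

Lemma del_rel_connect_sym : connect_sym (del_rel e S).
Proof.
by apply: sym_connect_sym => x y; rewrite /del_rel e_sym andbCA.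
Qed.

Lemma comp_root_del x : x \notin S -> comp_root x \notin S.
Proof.
move=> xS; have clS : closed (del_rel e S) [predC S].
  by move=> y z /and3P[yS zS _]; rewrite !inE yS zS.
have := closed_connect clS (connect_root (del_rel e S) x).
by rewrite !inE xS => <-.
Qed.

Lemma comp_root_in x : x \notin S -> comp_root x \in comp_roots.
Proof.
move=> xS; rewrite !inE comp_root_del //=.
by rewrite (root_root del_rel_connect_sym).
Qed.

Lemma comp_root_edge x y :
  x \notin S -> y \notin S -> e x y -> comp_root x = comp_root y.
Proof.
move=> xS yS exy; apply/eqP; rewrite (root_connect del_rel_connect_sym).
by apply: connect1; rewrite /del_rel xS yS.
Qed.

Lemma comp_set_root x : x \in comp_roots -> x \in comp_set x.
Proof. by rewrite !inE. Qed.

(** A nontrivial path from [x] to its root would start with an edge between kept vertices. *)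
Lemma independent_comp_set x :
  independent e (~: S) -> x \notin S -> comp_root x = x.
Proof.
move=> /forall_inP ind xS.
have /connectP[p] := connect_root (del_rel e S) x.
case: p => [//|y p] /= /andP[/and3P[_ yS exy] _] _.
have := ind x; rewrite inE => /(_ xS) /forall_inP/(_ y).
by rewrite inE exy => /(_ yS).
Qed.

Lemma independent_ncomp : independent e (~: S) -> ncomp_del e S = #|~: S|.
Proof.
move=> ind; rewrite ncomp_delE; apply: eq_card => x; rewrite !inE.
by case: (boolP (x \in S)) => //= xS;
   rewrite (independent_comp_set ind xS) eqxx.
Qed.

Lemma sum_comp_set (R : nmodType) (F : T -> R) :
  \sum_(y in ~: S) F y = \sum_(x in comp_roots) \sum_(y in comp_set x) F y.
Proof.
rewrite (partition_big comp_root (mem comp_roots)) /= => [|y]; last first.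
  by rewrite inE => /comp_root_in.
by apply: eq_bigr => x _; apply: eq_bigl => y; rewrite !inE.
Qed.

Lemma card_comp_set : #|~: S| = (\sum_(x in comp_roots) #|comp_set x|)%N.
Proof.
rewrite -sum1_card (sum_comp_set (fun _ => 1%N)).
by apply: eq_bigr => x _; rewrite sum1_card.
Qed.

Lemma sum_comp_edges (R : nmodType) (F : T -> T -> R) :
  \sum_(y in ~: S) \sum_(z in ~: S | e y z) F y z
  = \sum_(x in comp_roots) \sum_(y in comp_set x)
      \sum_(z in comp_set x | e y z) F y z.
Proof.
rewrite sum_comp_set; apply: eq_bigr => x _; apply: eq_bigr => y.
rewrite !inE => /andP[yS /eqP ry]; apply: eq_bigl => z.
rewrite !inE; case: (boolP (z \in S)) => //= zS.
case: (boolP (e y z)) => [eyz | _]; last by rewrite andbF.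
by rewrite -ry (comp_root_edge yS zS eyz) eqxx.
Qed.
End Components.

(** * Vertex and neighbour counts in Kneser graphs *)

Lemma kadj_sym n k : symmetric (@kadj n k).
Proof. by move=> v w; rewrite /kadj disjoint_sym. Qed.

Lemma card_kvert n k : #|{: kvert n k}| = 'C(n, k).
Proof. by rewrite card_sig -[in RHS](card_ord n) -card_draws cardsE. Qed.

Lemma card_kvert_disjoint n k (A : {set 'I_n}) :
  #|[set w : kvert n k | [disjoint A & val w]]| = 'C(n - #|A|, k).
Proof.
have <- : #|~: A| = (n - #|A|)%N by rewrite cardsCs setCK card_ord.
rewrite -cards_draws -(card_imset _ val_inj); apply: eq_card => B.
rewrite inE; apply/imsetP/andP => [[w] | [BA cB]].
  rewrite inE disjoint_sym disjoints_subset => Aw ->; split=> //.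
  exact: (valP w).
by exists (Sub B cB) => //; rewrite inE disjoint_sym disjoints_subset.
Qed.
(** The strict bound for a component of size [n] with [m] arcs, cleared of denominators. *)
Lemma comp_inequality (R : realFieldType) (n m : R) :
  2 <= n -> n <= 33 /\ m <= n * (n - 1)
    \/ 34 <= n <= 295 /\ m <= 31 * n + 4 / 330 * n ^+ 2 ->
  (n + 7 / 4) * (m + 20 * n) < 55 * n ^+ 2.
Proof.
move=> n2 [[n33 le_m] | [/andP[n34 n295] le_m]].
  (* This product is exactly the gap when [m = n * (n - 1)]; its root [133 / 4] explains the
     threshold 33. *)
  have p1 : 0 < n * ((n - 1) * (133 / 4 - n)).
    by apply: mulr_gt0; [lra | apply: mulr_gt0; lra].
  have p2 : 0 <= (n + 7 / 4) * (n * (n - 1) - m) by apply: mulr_ge0; lra.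
  lra.
(* For the largest [m], the gap is [4 / 330] of this product, plus [3 / 330] of that in [p3], plus a
   positive multiple of [n]. *)
have p1 : 0 <= n * ((n - 34) * (295 - n)).
  by apply: mulr_ge0; [lra | apply: mulr_ge0; lra].
have p2 : 0 <= (n + 7 / 4) * (31 * n + 4 / 330 * n ^+ 2 - m)
  by apply: mulr_ge0; lra.
have p3 : 0 <= n * (295 - n) by apply: mulr_ge0; lra.
lra.
Qed.


(** * Bounds for a vertex cut *)

Section Cut.
Variable R : realFieldType.
Implicit Types (S C : {set kvert 11 4}).
Notation e := (@kadj 11 4).

Definition arcs C : R := \sum_(v in C) \sum_(w in C | e v w) 1.

Lemma arcs_ge0 C : 0 <= arcs C.
Proof. by apply: sumr_ge0 => v _; apply: sumr_ge0. Qed.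

Lemma arcs_le_complete C : arcs C <= #|C|%:R * (#|C|%:R - 1).
Proof.
rewrite mulr_natl -sumr_const; apply: ler_sum => v vC.
rewrite (cardsD1 v C) vC natrD mulr1n addrAC subrr add0r sumr_const ler_nat.
apply/subset_leq_card/subsetP => w; rewrite !inE => /andP[-> evw].
rewrite andbT; apply: contraTneq evw => ->.
rewrite /kadj -setI_eq0 setIid -cards_eq0 (eqP (valP v)) //.
Qed.

Lemma arcs_indicator C :
  \sum_v \sum_(w | e v w) (v \in C)%:R * (w \in C)%:R = arcs C.
Proof.
rewrite [RHS]big_mkcond; apply: eq_bigr => v _.
case: (v \in C); last by rewrite big1 // => w _; rewrite mul0r.
rewrite [RHS]big_mkcondl; apply: eq_bigr => w _.
by rewrite mul1r; case: (w \in C).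
Qed.

Lemma sum_indicator C : \sum_v (v \in C)%:R = #|C|%:R :> R.
Proof.
rewrite -sum1_card natr_sum [RHS]big_mkcond; apply: eq_bigr => v _.
by case: (v \in C).
Qed.

Lemma sum_indicator_sqr C : \sum_v (v \in C)%:R ^+ 2 = #|C|%:R :> R.
Proof.
rewrite -sum_indicator; apply: eq_bigr => v _.
by case: (v \in C); rewrite ?expr1n ?expr0n.
Qed.

Lemma arcs_le_expansion C : arcs C <= 31 * #|C|%:R + 4 / 330 * #|C|%:R ^+ 2.
Proof.
have := quad_upper (fun v => (v \in C)%:R : R).
by rewrite arcs_indicator sum_indicator_sqr sum_indicator.
Qed.

(** The ratio bound: without arcs, [quad_lower] on the indicator of [C] reads
    [#|C| ^ 2 / 6 <= 20 * #|C|]. *)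
Lemma independent_card_le C : independent e C -> (#|C| <= 120)%N.
Proof.
move=> ind; have := quad_lower (fun v => (v \in C)%:R : R).
rewrite arcs_indicator sum_indicator_sqr sum_indicator.
have -> : arcs C = 0.
  rewrite /arcs big1 // => v vC; rewrite big_pred0 // => w.
  apply/negbTE; rewrite negb_and -implybE.
  by have /forall_inP/(_ v vC)/forallP := ind; apply.
rewrite -(ler_nat R) add0r; case: #|C| => [//|c] le_c.
have : 0 < c.+1%:R :> R by rewrite ltr0n.
nra.
Qed.

Variable S : {set kvert 11 4}.
Hypothesis cutS : vertex_cut e S.
Notation roots := (comp_roots e S).
Notation cmp := (comp_set e S).
Let e_sym : symmetric e := @kadj_sym 11 4.

Lemma card_comp_le x : x \in roots -> (#|cmp x| <= 295)%N.
Proof.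
move=> xR; have [y yR yx] : exists2 y, y \in roots & y != x.
  have := cutS; rewrite /vertex_cut ncomp_delE (cardsD1 x) xR ltnS.
  by case/card_gt0P=> y; rewrite in_setD1 => /andP[yx yR]; exists y.
have disj : [disjoint cmp x & [set z | e y z]].
  apply/pred0P => z; apply/negbTE; rewrite !inE; apply/negP.
  case/andP=> /andP[zS /eqP rz] eyz; case/negP: yx.
  have := yR; rewrite inE inE => /andP[yS /eqP ry].
  by rewrite -rz -ry (comp_root_edge e_sym yS zS eyz).
have := max_card (cmp x :|: [set z | e y z]).
rewrite cardsU disjoint_setI0 // cards0 subn0 card_kvert.
rewrite card_kvert_disjoint (eqP (valP y)).
rewrite (_ : 'C(11 - 4, 4) = 35%N) // (_ : 'C(11, 4) = 330%N) //; lia.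
Qed.

Lemma card_comp_gt0 x : x \in roots -> (0 < #|cmp x|)%N.
Proof. by move=> /comp_set_root xC; apply/card_gt0P; exists x. Qed.

(** The optimal test value by Cauchy-Schwarz: it makes the linear and quadratic contributions of a
    component to [quad_lower] equal. *)
Definition weight x : R := #|cmp x|%:R / (arcs (cmp x) + 20 * #|cmp x|%:R).

Lemma weight_sum_le : \sum_(x in roots) #|cmp x|%:R * weight x <= 6.
Proof.
pose f (v : kvert 11 4) : R :=
  if v \in ~: S then weight (fingraph.root (del_rel e S) v) else 0.
have fE x v : x \in roots -> v \in cmp x -> f v = weight x.
  by rewrite /f !inE => _ /andP[vS /eqP ->]; rewrite vS.
set G := \sum_(x in _) _.
have den x : x \in roots -> 0 < arcs (cmp x) + 20 * #|cmp x|%:R.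
  move=> /card_comp_gt0 n0; apply: ltr_wpDl (arcs_ge0 _) _.
  by rewrite mulr_gt0 // ltr0n.
(* [F 0 = 0] discards the deleted vertices, where [f] is 0. *)
have sumE (F : R -> R) : F 0 = 0 ->
  \sum_v F (f v) = \sum_(x in roots) #|cmp x|%:R * F (weight x).
  move=> F0; rewrite (bigID (mem (~: S))) /=.
  rewrite [X in _ + X]big1 ?addr0; last first.
    by move=> v vS; rewrite /f (negbTE vS).
  rewrite (sum_comp_set _ e_sym); apply: eq_bigr => x xR.
  rewrite mulr_natl -sumr_const; apply: eq_bigr => v vC.
  by rewrite (fE x v).
have sum_f : \sum_v f v = G by rewrite (sumE id).
have sum_f2 : \sum_v f v ^+ 2 = \sum_(x in roots) #|cmp x|%:R * weight x ^+ 2.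
  by have := sumE (fun a => a ^+ 2); rewrite expr0n; apply.
have quad_f : \sum_v \sum_(w | e v w) f v * f w
    = \sum_(x in roots) weight x ^+ 2 * arcs (cmp x).
  transitivity (\sum_(v in ~: S) \sum_(w in ~: S | e v w) f v * f w).
    rewrite [RHS]big_mkcond; apply: eq_bigr => v _.
    rewrite big_mkcondl /=; case: ifP => vS; last first.
      by rewrite big1 // => w _; rewrite /f vS mul0r.
    apply: eq_bigr => w _; case: ifP => // wS.
    by rewrite /f wS mulr0.
  rewrite (sum_comp_edges _ e_sym); apply: eq_bigr => x xR.
  rewrite mulr_sumr; apply: eq_bigr => v vC.
  rewrite mulr_sumr; apply: eq_bigr => w /andP[wC _].
  by rewrite (fE x v) // (fE x w) // mulr1 expr2.
have := quad_lower f.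
rewrite [X in _ <= X + _]quad_f [X in _ <= _ + 20 * X]sum_f2 sum_f.
rewrite mulr_sumr -big_split /=.
rewrite [X in _ <= X](_ : _ = G) => [G2|]; last first.
  apply: eq_bigr => x xR; have := lt0r_neq0 (den x xR).
  by rewrite /weight; set n := _%:R; set m := arcs _ => ?; field.
 (* [quad_lower] has become [G ^ 2 / 6 <= G]. *)
 have [] := ltP 0 G; nra.
Qed.

(** Here 55 is [330 / 6], matching [weight_sum_le]. A singleton has no arcs and both sides are
    [1 / 20]. The [leif] form carries the equality case through the sum. *)
Lemma comp_bound x : x \in roots ->
  (#|cmp x|%:R + 7 / 4) / 55 <= #|cmp x|%:R * weight x ?= iff (#|cmp x| == 1)%N.
Proof.
move=> xR; have n0 := card_comp_gt0 xR.
have n0R : 0 < #|cmp x|%:R :> R by rewrite ltr0n.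
have m0 := arcs_ge0 (cmp x); have mK := arcs_le_complete (cmp x).
have den : 0 < arcs (cmp x) + 20 * #|cmp x|%:R by lra.
have [n1 | n_neq1] := eqVneq #|cmp x| 1%N.
  apply/leifP; rewrite /weight n1; rewrite n1 in mK.
  have -> : arcs (cmp x) = 0 by lra.
  by apply/eqP; field.
apply/leifP; rewrite /weight mulrA ltr_pdivlMr // mulrAC ltr_pdivrMr //.
rewrite [ltRHS]mulrC -expr2; apply: comp_inequality.
  by rewrite ler_nat ltn_neqAle eq_sym n_neq1.
have := card_comp_le xR.
have [le33 | gt33] := leqP #|cmp x| 33; [left | right].
  by rewrite ler_nat.
by rewrite !ler_nat gt33; split=> //; exact: arcs_le_expansion.
Qed.

Lemma sum_comp_bound :
  \sum_(x in roots) (#|cmp x|%:R + 7 / 4) / 55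
  = ((330 - #|S|%:R) + 7 / 4 * (ncomp_del e S)%:R) / 55 :> R.
Proof.
have cardU : \sum_(x in roots) #|cmp x|%:R = 330%:R - #|S|%:R :> R.
  rewrite -natr_sum -(card_comp_set S e_sym) cardsCs setCK card_kvert natrB //.
  by rewrite -(card_kvert 11 4) max_card.
by rewrite -mulr_suml big_split /= sumr_const (ncomp_delE e) cardU
           [7 / 4 * _]mulr_natr.
Qed.

Lemma cut_size_ge : 7 / 4 * (ncomp_del e S)%:R <= #|S|%:R :> R.
Proof.
have [] := leif_sum comp_bound.
rewrite sum_comp_bound => le_sum _; have := weight_sum_le; lra.
Qed.

Lemma cut_size_eq :
  7 / 4 * (ncomp_del e S)%:R = #|S|%:R :> R -> independent e (~: S).
Proof.
move=> eqS; have [le_sum eq_sum] := leif_sum comp_bound.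
(* The hypothesis makes the lower bounds sum to 6, so every component bound is tight. *)
have /forall_inP singl : [forall (x | x \in roots), (#|cmp x| == 1)%N].
  rewrite -eq_sum; apply/eqP; move: le_sum; rewrite sum_comp_bound.
  have := weight_sum_le; lra.
apply/forall_inP => v vS; apply/forall_inP => w wS; apply/negP => vw.
rewrite !inE in vS wS.
(* Adjacent kept vertices would share a singleton component, so a nonempty set would be disjoint
   from itself. *)
have rv := comp_root_in e_sym vS; have /cards1P[x Cx] := singl _ rv.
have : v \in cmp (fingraph.root (del_rel e S) v) by rewrite !inE vS eqxx.
have : w \in cmp (fingraph.root (del_rel e S) v).
  by rewrite !inE wS (comp_root_edge e_sym vS wS vw) eqxx.
rewrite Cx !inE => /eqP wx /eqP vx; move: vw.
by rewrite wx vx /kadj -setI_eq0 setIid -cards_eq0 (eqP (valP x)).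
Qed.
End Cut.

(** * The extremal example: all vertices through one point *)

Definition star : {set kvert 11 4} := 
  [set v : kvert 11 4 | ord0 \in (val v : {set 'I_11})].

Lemma card_star : #|star| = 120%N.
Proof.
have := cardsC star; rewrite card_kvert.
rewrite (_ : ~: star
  = [set v : kvert 11 4 | [disjoint [set (ord0 : 'I_11)] & val v]]).
  rewrite card_kvert_disjoint cards1.
  by rewrite (_ : 'C(11 - 1, 4) = 210%N) // (_ : 'C(11, 4) = 330%N) //; lia.
by apply/setP => v; rewrite !inE disjoints1.
Qed.

Lemma star_independent : independent (@kadj 11 4) star.
Proof.
apply/forall_inP => v v0; apply/forall_inP => w w0.
apply/negP => /pred0P/(_ ord0).
by rewrite !inE in v0 w0; rewrite /= v0 w0.
Qed.

(** * Toughness and the equality case *)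

Lemma card_setC_kvert (S : {set kvert 11 4}) : (#|S| + #|~: S| = 330)%N.
Proof. by rewrite cardsC card_kvert. Qed.

Lemma cut_ratio_eq (S : {set kvert 11 4}) :
  vertex_cut (@kadj 11 4) S ->
  cut_ratio (@kadj 11 4) S = 7%:R / 4%:R <->
  7 / 4 * (ncomp_del (@kadj 11 4) S)%:R = #|S|%:R :> rat.
Proof.
rewrite /vertex_cut /cut_ratio; case: (ncomp_del _ _) => [//|c] _.
have c0 : c.+1%:R != 0 :> rat by rewrite pnatr_eq0.
by split=> [<- | <-]; rewrite ?divfK ?mulfK.
Qed.

Local Close Scope ring_scope.

Theorem theorem5p3 :
  is_toughness (@kadj 11 4) (7%:R / 4%:R)%R /\
  (forall S : {set kvert 11 4},
      vertex_cut (@kadj 11 4) S ->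
      cut_ratio (@kadj 11 4) S = (7%:R / 4%:R)%R ->
      exists I : {set kvert 11 4},
        max_independent (@kadj 11 4) I /\ S = ~: I).
Proof.
split; last first.
  move=> S cutS /(cut_ratio_eq cutS) eqS; exists (~: S).
  rewrite setCK; split=> //.
  have ind := cut_size_eq cutS eqS; rewrite /max_independent ind /=.
  (* Independence makes [#|~: S|] the number of components, so [7 / 4 * #|~: S| = 330 - #|~: S|]. *)
  have card120 : #|~: S| = 120.
    move: eqS; rewrite (independent_ncomp ind).
    have /(congr1 (fun m : nat => m%:R%R : rat)) := card_setC_kvert S.
    rewrite natrD => cardS eqS; apply/eqP; rewrite -(eqr_nat rat); apply/eqP.
    lra.
  apply/forallP => J; apply/implyP.
  rewrite card120; apply: (independent_card_le rat).
split; last first.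
  move=> S cutS; have := cut_size_ge rat cutS; move: cutS.
  rewrite /vertex_cut /cut_ratio; case: (ncomp_del _ _) => [//|c] _.
  by rewrite ler_pdivlMr // ltr0n.
have ind : independent (@kadj 11 4) (~: ~: star).
  by rewrite setCK star_independent.
have nc : ncomp_del (@kadj 11 4) (~: star) = 120.
  by rewrite (independent_ncomp ind) setCK card_star.
have cut : vertex_cut (@kadj 11 4) (~: star) by rewrite /vertex_cut nc.
(* Deleting 210 vertices leaves 120 isolated ones, with ratio [7 / 4]. *)
exists (~: star); split=> //; apply/(cut_ratio_eq cut); rewrite nc.
have := card_setC_kvert star; rewrite card_star => /(@addnI 120 _ 210) ->.
lra.
Qed.
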